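(* For $n\ge1$, the algorithm $\mathsf M_n$ (described in the context) multiplies two elements of $A_n$ using $O(n2^n)$ real arithmetic operations. Equivalently, for $N=2^n$, $O(N\log N)$ operations suffice. For $n=0$, one real multiplication suffices.
   Context: **Cayley--Dickson tower.** $A_0:=\mathbb R$ with $\bar r=r$. Recursively $A_n:=A_{n-1}\oplus A_{n-1}$ with $$\overline{(a,b)}=(\bar a,-b),\qquad (a,b)(c,d)=\bigl(ac-\bar d\,b,\;da+b\bar c\bigr).$$ The standard (recursive, concatenated) basis identifies $A_n$ with $\mathbb R^{2^n}$ and gives its Euclidean inner product $\langle\cdot,\cdot\rangle$. Scalars are identified with multiples of the unit. Put $\operatorname{Re}(x)=\frac{x+\bar x}{2}$ (identified with its scalar coefficient), $\operatorname{Im}(x)=\frac{x-\bar x}{2}$, $V_n:=\operatorname{Im}(A_n)=\{x\in A_n:\bar x=-x\}$. **The algorithm.** Let $V_n^{\mathbb C}=V_n\otimes_{\mathbb R}\mathbb C$, $\mathbb C=\mathbb R(\iota)$, $\iota^2=-1$, with the involution extended $\mathbb C$-linearly and $\langle z,w\rangle_{\mathrm{bil}}=\sum_j z_jw_j$ (no conjugation). For $n\ge2$ every element of $V_n^{\mathbb C}$ (resp. $V_n$) is uniquely $(u,\gamma+s)$ with $u,s\in V_{n-1}^{\mathbb C}$, $\gamma\in\mathbb C$ (resp. $u,s\in V_{n-1}$, $\gamma\in\mathbb R$). $\operatorname{Re}_{\mathrm c},\operatorname{Im}_{\mathrm c}$ denote coefficientwise real and imaginary parts. - $\mathsf C_n(X,Y)$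 for $n\ge 1$, $X,Y\in V_n^{\mathbb C}$: if $n=1$ return $0$. Otherwise write $X=(u,\gamma+s)$, $Y=(v,\delta+t)$; set $Z_\pm\leftarrow\mathsf C_{n-1}(u\pm\iota s,v\pm\iota t)$, $\lambda\leftarrow\langle s,v\rangle_{\mathrm{bil}}-\langle t,u\rangle_{\mathrm{bil}}$, $F\leftarrow (Z_++Z_-)/2+\gamma t-\delta s$, $G\leftarrow\lambda+\delta u-\gamma v+\iota(Z_+-Z_-)/2$; return $(F,G)$. - $\mathsf R_n(X,Y)$ for $n\ge 1$, $X,Y\in V_n$: if $n=1$ return $0$. Otherwise write $X=(u,\gamma+s)$, $Y=(v,\delta+t)$; set $Z\leftarrow\mathsf C_{n-1}(u+\iota s,v+\iota t)$, $\lambda\leftarrow\langle s,v\rangle-\langle t,u\rangle$, $F\leftarrow\operatorname{Re}_{\mathrm c}Z+\gamma t-\delta s$, $G\leftarrow\lambda+\delta u-\gamma v-\operatorname{Im}_{\mathrm c}Z$; return $(F,G)$. - $\mathsf M_n(x,y)$ for $n\ge 0$, $x,y\in A_n$: if $n=0$ return the real product $xy$. Otherwise set $\alpha=\operatorname{Re}(x)$, $X=\operatorname{Im}(x)$, $\beta=\operatorname{Re}(y)$, $Y=\operatorname{Im}(y)$, $Z\leftarrow\mathsf R_n(X,Y)$; return $(\alpha\beta-\langle X,Y\rangle)+\alpha Y+\beta X+Z$. **Cost model.** Real additions, subtractions, and multiplications (including by fixed constants) are counted at unit cost; complex arithmetic is carried out in real coordinates over $\mathbb R(\iota)$. Logarithms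 are to base two; the implied constants are independent of $n$. *)

(* Defs.v *)
From mathcomp Require Import all_boot all_order all_algebra.

Set Implicit Arguments.
Unset Strict Implicit.
Unset Printing Implicit Defensive.

Import Order.TTheory GRing.Theory Num.Theory.
Local Open Scope ring_scope.

(* Elements of A_n in the recursive, concatenated basis: [cd T n] is T^(2^n),
   bracketed as nested pairs.  A_n itself is [cd R n]. *)
Fixpoint cd (T : Type) (n : nat) : Type :=
  if n is m.+1 then (cd T m * cd T m)%type else T.

Fixpoint cdadd (R : realFieldType) (n : nat) : cd R n -> cd R n -> cd R n :=
  if n is m.+1 return cd R n -> cd R n -> cd R n then
    fun x y => (cdadd x.1 y.1, cdadd x.2 y.2)
  else fun x y => x + y.

Fixpoint cdscale (R : realFieldType) (c : R) (n : nat) : cd R n -> cd R n :=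
  if n is m.+1 return cd R n -> cd R n then
    fun x => (cdscale c x.1, cdscale c x.2)
  else fun x => c * x.

Fixpoint cdopp (R : realFieldType) (n : nat) : cd R n -> cd R n :=
  if n is m.+1 return cd R n -> cd R n then
    fun x => (cdopp x.1, cdopp x.2)
  else fun x => - x.

Definition cdsub (R : realFieldType) (n : nat) (x y : cd R n) : cd R n :=
  cdadd x (cdopp y).

Fixpoint cdconj (R : realFieldType) (n : nat) : cd R n -> cd R n :=
  if n is m.+1 return cd R n -> cd R n then
    fun x => (cdconj x.1, cdopp x.2)
  else fun x => x.

Fixpoint cdmul (R : realFieldType) (n : nat) : cd R n -> cd R n -> cd R n :=
  if n is m.+1 return cd R n -> cd R n -> cd R n then
    fun x y =>
      let: (a, b) := x in let: (c, d) := y in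
      (cdsub (cdmul a c) (cdmul (cdconj d) b),
       cdadd (cdmul d a) (cdmul b (cdconj c)))
  else fun x y => x * y.

(* The 2^n - 1 coordinates of V_n (T real scalars) or of its complexification
   (T complex scalars).  An element (u, gamma + s) of V_n is the nested tuple
   (u, (gamma, s)), with V_0 = 0. *)
Fixpoint imv (T : Type) (n : nat) : Type :=
  if n is m.+1 then (imv T m * (T * imv T m))%type else unit.

Fixpoint cdsplit (T : Type) (n : nat) : cd T n -> T * imv T n :=
  if n is m.+1 return cd T n -> T * imv T n then
    fun x => ((cdsplit x.1).1, ((cdsplit x.1).2, cdsplit x.2))
  else fun x => (x, tt).

Fixpoint cdjoin (T : Type) (n : nat) : T -> imv T n -> cd T n :=
  if n is m.+1 return T -> imv T n -> cd T n then
    fun a X => (cdjoin a X.1, cdjoin X.2.1 X.2.2)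
  else fun a _ => a.

Fixpoint vconst (T : Type) (c : T) (n : nat) : imv T n :=
  if n is m.+1 return imv T n then (vconst c m, (c, vconst c m)) else tt.

Definition cdscalar (R : realFieldType) (n : nat) (a : R) : cd R n :=
  cdjoin a (vconst 0 n).

(* The lemmas below check that the components of [cdsplit] are
   Re(x) = (x + conj x) / 2 and Im(x) = (x - conj x) / 2, and that [imv R n]
   parametrizes V_n = {x | conj x = - x}. *)

Lemma cdsplitK (T : Type) (n : nat) (x : cd T n) :
  cdjoin (cdsplit x).1 (cdsplit x).2 = x.
Proof.
elim: n x => [//|n IHn] /= [a b] /=.
by rewrite !IHn.
Qed.

Lemma cdjoinK (T : Type) (n : nat) (a : T) (X : imv T n) :
  cdsplit (cdjoin a X) = (a, X).
Proof.
elim: n a X => [a [] //|n IHn] a /= [u [g s]] /=.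
by rewrite !IHn.
Qed.

Lemma cdsplit_Re (R : realFieldType) (n : nat) (x : cd R n) :
  cdscalar n (cdsplit x).1 = cdscale 2^-1 (cdadd x (cdconj x)).
Proof.
rewrite /cdscalar; elim: n x => [|n IHn] /= x.
  by rewrite -mulr2n -[x *+ 2]mulr_natl mulKf ?pnatr_eq0.
rewrite IHn; congr pair; move: x.2 => {IHn x} z.
elim: n z => [|n IHn] /= z.
  by rewrite subrr mulr0.
by rewrite -!IHn.
Qed.

Lemma cdsplit_Im (R : realFieldType) (n : nat) (x : cd R n) :
  cdjoin 0 (cdsplit x).2 = cdscale 2^-1 (cdsub x (cdconj x)).
Proof.
rewrite /cdsub; elim: n x => [|n IHn] /= x; first by rewrite subrr mulr0.
rewrite IHn; congr pair; rewrite cdsplitK.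
move: x.2 => {IHn x} z; elim: n z => [|n IHn] /= z; last first.
  by rewrite -!IHn -surjective_pairing.
by rewrite opprK -mulr2n -[z *+ 2]mulr_natl mulKf ?pnatr_eq0.
Qed.

Lemma cdsplit_V (R : realFieldType) (n : nat) (x : cd R n) :
  cdconj x = cdopp x <-> (cdsplit x).1 = 0.
Proof.
elim: n x => [|n IHn] /= x; last first.
  by split=> [[/IHn]|/IHn ->].
by split=> [/eqP|->]; rewrite ?oppr0 // eq_sym eqNr => /eqP.
Qed.

Inductive arith_op := Add | Sub | Mul.

(* A program returning a [T], whose real registers have type [S].  As the
   algorithms below are polymorphic in [S], instructions are their only way to
   compute with reals; there is no branching on values. [Lit] makes a fixed
   constant of [R] available and is free, but operating on it is not. *)
Inductive prog (R S T : Type) : Type :=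
  | Ret of T
  | Lit of R & (S -> prog R S T)
  | Op of arith_op & S & S & (S -> prog R S T).

Arguments Ret {R S T}.
Arguments Lit {R S T}.
Arguments Op {R S T}.

Fixpoint bind (R S T U : Type) (p : prog R S T) (f : T -> prog R S U) :
    prog R S U :=
  match p with
  | Ret a => f a
  | Lit c k => Lit c (fun r => bind (k r) f)
  | Op o a b k => Op o a b (fun r => bind (k r) f)
  end.

Notation "'let!' x ':=' p 'in' q" := (bind p (fun x => q))
  (at level 200, x name, p at level 200, q at level 200,
   format "'[v' 'let!'  x  ':='  p  'in' '/' q ']'").

Definition arith (R : realFieldType) (o : arith_op) (a b : R) : R :=
  match o with Add => a + b | Sub => a - b | Mul => a * b end.

Fixpoint result (R : realFieldType) (T : Type) (p : prog R R T) : T :=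
  match p with
  | Ret a => a
  | Lit c k => result (k c)
  | Op o a b k => result (k (arith o a b))
  end.

Fixpoint ops (R : realFieldType) (T : Type) (p : prog R R T) : seq arith_op :=
  match p with
  | Ret _ => [::]
  | Lit c k => ops (k c)
  | Op o a b k => o :: ops (k (arith o a b))
  end.

Definition cost (R : realFieldType) (T : Type) (p : prog R R T) : nat :=
  size (ops p).

Definition rlit (R S : Type) (c : R) : prog R S S := Lit c Ret.
Definition radd (R S : Type) (a b : S) : prog R S S := Op Add a b Ret.
Definition rsub (R S : Type) (a b : S) : prog R S S := Op Sub a b Ret.
Definition rmul (R S : Type) (a b : S) : prog R S S := Op Mul a b Ret.

(* [(a, b)] stands for a + iota b *)
Definition cplx (S : Type) : Type := (S * S)%type.

Definition clit0 (R : realFieldType) (S : Type) : prog R S (cplx S) :=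
  let! z := rlit S (0 : R) in Ret (z, z).

Definition cadd (R S : Type) (z w : cplx S) : prog R S (cplx S) :=
  let! a := radd R z.1 w.1 in
  let! b := radd R z.2 w.2 in
  Ret (a, b).

Definition csub (R S : Type) (z w : cplx S) : prog R S (cplx S) :=
  let! a := rsub R z.1 w.1 in
  let! b := rsub R z.2 w.2 in
  Ret (a, b).

Definition cmul (R S : Type) (z w : cplx S) : prog R S (cplx S) :=
  let! p := rmul R z.1 w.1 in
  let! q := rmul R z.2 w.2 in
  let! r := rmul R z.1 w.2 in
  let! s := rmul R z.2 w.1 in
  let! a := rsub R p q in
  let! b := radd R r s in
  Ret (a, b).

Definition chalf (R : realFieldType) (S : Type) (z : cplx S) :
    prog R S (cplx S) :=
  let! h := rlit S (2^-1 : R) in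
  let! a := rmul R h z.1 in
  let! b := rmul R h z.2 in
  Ret (a, b).

(* z + iota w and z - iota w *)
Definition caddi (R S : Type) (z w : cplx S) : prog R S (cplx S) :=
  let! a := rsub R z.1 w.2 in
  let! b := radd R z.2 w.1 in
  Ret (a, b).

Definition csubi (R S : Type) (z w : cplx S) : prog R S (cplx S) :=
  let! a := radd R z.1 w.2 in
  let! b := rsub R z.2 w.1 in
  Ret (a, b).

Fixpoint vmap (R S T U : Type) (f : T -> prog R S U) (n : nat) :
    imv T n -> prog R S (imv U n) :=
  if n is m.+1 return imv T n -> prog R S (imv U n) then
    fun X =>
      let: (u, (g, s)) := X in
      let! u' := vmap f u in
      let! g' := f g in
      let! s' := vmap f s in
      Ret (u', (g', s'))
  else fun _ => Ret tt.

Fixpoint vmap2 (R S T U W : Type) (f : T -> U -> prog R S W) (n : nat) :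
    imv T n -> imv U n -> prog R S (imv W n) :=
  if n is m.+1 return imv T n -> imv U n -> prog R S (imv W n) then
    fun X Y =>
      let: (u, (g, s)) := X in let: (v, (d, t)) := Y in
      let! u' := vmap2 f u v in
      let! g' := f g d in
      let! s' := vmap2 f s t in
      Ret (u', (g', s'))
  else fun _ _ => Ret tt.

(* The bilinear form sum_j z_j w_j.  The additions to [zero] at the leaves are
   counted as well. *)
Fixpoint vdot (R S T : Type) (zero : prog R S T)
    (add mul : T -> T -> prog R S T) (n : nat) :
    imv T n -> imv T n -> prog R S T :=
  if n is m.+1 return imv T n -> imv T n -> prog R S T then
    fun X Y =>
      let: (u, (g, s)) := X in let: (v, (d, t)) := Y in
      let! p := vdot zero add mul u v in
      let! q := mul g d in
      let! r := vdot zero add mul s t in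
      let! pq := add p q in
      add pq r
  else fun _ _ => zero.

(* Pure data movement: u + iota s for real u and s, and coefficientwise real
   and imaginary parts. *)
Fixpoint vcplx (S : Type) (n : nat) : imv S n -> imv S n -> imv (cplx S) n :=
  if n is m.+1 return imv S n -> imv S n -> imv (cplx S) n then
    fun X Y =>
      let: (u, (g, s)) := X in let: (v, (d, t)) := Y in
      (vcplx u v, ((g, d), vcplx s t))
  else fun _ _ => tt.

Fixpoint vRe (S : Type) (n : nat) : imv (cplx S) n -> imv S n :=
  if n is m.+1 return imv (cplx S) n -> imv S n then
    fun X => let: (u, (g, s)) := X in (vRe u, (g.1, vRe s))
  else fun _ => tt.

Fixpoint vIm (S : Type) (n : nat) : imv (cplx S) n -> imv S n :=
  if n is m.+1 return imv (cplx S) n -> imv S n then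
    fun X => let: (u, (g, s)) := X in (vIm u, (g.2, vIm s))
  else fun _ => tt.

Definition rvadd (R S : Type) (n : nat) (X Y : imv S n) := vmap2 (@radd R S) X Y.
Definition rvsub (R S : Type) (n : nat) (X Y : imv S n) := vmap2 (@rsub R S) X Y.
Definition rvscale (R S : Type) (n : nat) (c : S) (X : imv S n) :=
  vmap (rmul R c) X.
Definition rvdot (R : realFieldType) (S : Type) (n : nat) (X Y : imv S n) :=
  vdot (rlit S (0 : R)) (@radd R S) (@rmul R S) X Y.

Definition cvadd (R S : Type) (n : nat) (X Y : imv (cplx S) n) :=
  vmap2 (@cadd R S) X Y.
Definition cvsub (R S : Type) (n : nat) (X Y : imv (cplx S) n) :=
  vmap2 (@csub R S) X Y.
Definition cvaddi (R S : Type) (n : nat) (X Y : imv (cplx S) n) :=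
  vmap2 (@caddi R S) X Y.
Definition cvsubi (R S : Type) (n : nat) (X Y : imv (cplx S) n) :=
  vmap2 (@csubi R S) X Y.
Definition cvhalf (R : realFieldType) (S : Type) (n : nat)
    (X : imv (cplx S) n) :=
  vmap (@chalf R S) X.
Definition cvscale (R S : Type) (n : nat) (c : cplx S) (X : imv (cplx S) n) :=
  vmap (@cmul R S c) X.
Definition cvdot (R : realFieldType) (S : Type) (n : nat)
    (X Y : imv (cplx S) n) :=
  vdot (clit0 R S) (@cadd R S) (@cmul R S) X Y.

(* The algorithms C_n, R_n and M_n.  C and R are only meant for n >= 1; their
   value at n = 0 is irrelevant, as V_0 = 0.  The scalar lambda is the leading
   coordinate of G = lambda + Im(G), so adding it to the rest is free. *)
Fixpoint algC (R : realFieldType) (S : Type) (n : nat) :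
    imv (cplx S) n -> imv (cplx S) n -> prog R S (imv (cplx S) n) :=
  match n return imv (cplx S) n -> imv (cplx S) n ->
                 prog R S (imv (cplx S) n) with
  | 0%N => fun _ _ => Ret tt
  | m.+1 => fun X Y =>
    if m is 0%N then let! z := clit0 R S in Ret (vconst z m.+1) else
    let: (u, (gamma, s)) := X in
    let: (v, (delta, t)) := Y in
    let! Xp := cvaddi R u s in
    let! Yp := cvaddi R v t in
    let! Zp := algC R Xp Yp in
    let! Xm := cvsubi R u s in
    let! Ym := cvsubi R v t in
    let! Zm := algC R Xm Ym in
    let! sv := cvdot R s v in
    let! tu := cvdot R t u in
    let! lambda := csub R sv tu in
    let! Zsum := cvadd R Zp Zm in
    let! Zsum2 := cvhalf R Zsum in
    let! gt := cvscale R gamma t in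
    let! ds := cvscale R delta s in
    let! F0 := cvadd R Zsum2 gt in
    let! F := cvsub R F0 ds in
    let! Zdiff := cvsub R Zp Zm in
    let! Zdiff2 := cvhalf R Zdiff in
    let! du := cvscale R delta u in
    let! gv := cvscale R gamma v in
    let! G0 := cvsub R du gv in
    let! G := cvaddi R G0 Zdiff2 in
    Ret (F, (lambda, G))
  end.

Definition algR (R : realFieldType) (S : Type) (n : nat) :
    imv S n -> imv S n -> prog R S (imv S n) :=
  match n return imv S n -> imv S n -> prog R S (imv S n) with
  | 0%N => fun _ _ => Ret tt
  | m.+1 => fun X Y =>
    if m is 0%N then let! z := rlit S (0 : R) in Ret (vconst z m.+1) else
    let: (u, (gamma, s)) := X in
    let: (v, (delta, t)) := Y in
    let! Z := algC R (vcplx u s) (vcplx v t) in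
    let! sv := rvdot R s v in
    let! tu := rvdot R t u in
    let! lambda := rsub R sv tu in
    let! gt := rvscale R gamma t in
    let! ds := rvscale R delta s in
    let! F0 := rvadd R (vRe Z) gt in
    let! F := rvsub R F0 ds in
    let! du := rvscale R delta u in
    let! gv := rvscale R gamma v in
    let! G0 := rvsub R du gv in
    let! G := rvsub R G0 (vIm Z) in
    Ret (F, (lambda, G))
  end.

Definition algM (R : realFieldType) (S : Type) (n : nat) :
    cd S n -> cd S n -> prog R S (cd S n) :=
  match n return cd S n -> cd S n -> prog R S (cd S n) with
  | 0%N => fun x y => rmul R x y
  | m.+1 => fun x y =>
    let: (alpha, X) := cdsplit (x : cd S m.+1) in
    let: (beta, Y) := cdsplit (y : cd S m.+1) in
    let! Z := algR R X Y in
    let! ab := rmul R alpha beta in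
    let! XY := rvdot R X Y in
    let! c := rsub R ab XY in
    let! aY := rvscale R alpha Y in
    let! bX := rvscale R beta X in
    let! W0 := rvadd R aY bX in
    let! W := rvadd R W0 Z in
    Ret (cdjoin c W)
  end.

(* Main.v *)
Require Import Defs.
From mathcomp Require Import all_boot all_order all_algebra.
From mathcomp Require Import reals exp.
From mathcomp Require Import zify ring.

Import Order.TTheory GRing.Theory Num.Theory.
Local Open Scope ring_scope.

(** Write X x Y for the imaginary part of the product of two imaginary
    elements.  This operation is bilinear and antisymmetric, the real part of
    XY is - <X, Y>, and so
      (a + X) (b + Y) = (ab - <X, Y>) + (aY + bX + X x Y),
    which leaves X x Y as the only expensive term.  Expanding the doubling
    formula for X = (u, g + s) and Y = (v, d + t) gives
      X x Y = (u x v - s x t + g t - d s,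
               (<s, v> - <t, u>) + d u - g v - (u x t + s x v)).
    The vector parts of this formula involve four products of half size, but
    only through u x v - s x t and u x t + s x v.  These are the real and
    imaginary parts of (u + i s) x (v + i t), so one complex product of half
    size is enough for a real one.  When u, s, v, t are themselves complex,
    the two combinations are recovered as half the sum and half the difference
    (divided by i) of (u + i s) x (v + i t) and (u - i s) x (v - i t), so two
    complex products of half size are enough for a complex one.

    For correctness, [cdmul_join] establishes the decomposition of the product
    for the [cross] defined by the formula above, and [result_algC] shows that
    the complex algorithm computes the complex bilinear extension of [cross],
    expressed through coefficientwise real and imaginary parts.  For the cost,
    all the work outside the recursive calls is linear in the dimension, so
    the complex algorithm satisfies T(n+1) <= 2 T(n) + 34 * 2^(n+1), whence
    T(n) <= 34 n 2^n ([cost_algC]); the other two algorithms add only a linear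
    overhead to a single call of it ([cost_algM]). *)

(** * Vectors by coordinates *)

(** The coordinates of [imv T n], indexed along its tree structure: [inl] for
    those of u in (u, gamma + s), [inr None] for gamma, [inr (Some _)] for
    those of s.  Vector identities are proved coordinate by coordinate, where
    they become ring identities. *)
Fixpoint idx (n : nat) : Type :=
  if n is m.+1 then (idx m + option (idx m))%type else Empty_set.

Fixpoint vget {T : Type} {n : nat} : imv T n -> idx n -> T :=
  if n is m.+1 return imv T n -> idx n -> T then
    fun X i => match i with
               | inl j => vget X.1 j
               | inr None => X.2.1
               | inr (Some j) => vget X.2.2 j
               end
  else fun _ i => match i with end.

Fixpoint vtab {T : Type} {n : nat} : (idx n -> T) -> imv T n :=
  if n is m.+1 return (idx n -> T) -> imv T n then
    fun f => (vtab (fun j => f (inl j)),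
              (f (inr None), vtab (fun j => f (inr (Some j)))))
  else fun _ => tt.

Lemma vext (T : Type) (n : nat) (X Y : imv T n) :
  (forall i, vget X i = vget Y i) -> X = Y.
Proof.
elim: n X Y => [[] []//|n IHn] [u [g s]] [v [d t]] eqXY.
congr (_, (_, _)); first by apply: IHn => i; apply: (eqXY (inl i)).
  exact: (eqXY (inr None)).
by apply: IHn => i; apply: (eqXY (inr (Some i))).
Qed.

Lemma vgetK (T : Type) (n : nat) (f : idx n -> T) i : vget (vtab f) i = f i.
Proof. by elim: n f i => [f []|n IHn] f [j|[j|]] //=; rewrite IHn. Qed.

Lemma vget_vRe (S : Type) (n : nat) (X : imv (cplx S) n) i :
  vget (vRe X) i = (vget X i).1.
Proof. by elim: n X i => [X []|n IHn] [u [g s]] [j|[j|]] /=. Qed.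

Lemma vget_vIm (S : Type) (n : nat) (X : imv (cplx S) n) i :
  vget (vIm X) i = (vget X i).2.
Proof. by elim: n X i => [X []|n IHn] [u [g s]] [j|[j|]] /=. Qed.

Lemma vRe_vcplx (S : Type) (n : nat) (X Y : imv S n) : vRe (vcplx X Y) = X.
Proof.
by elim: n X Y => [[] []//|n IHn] [u [g s]] [v [d t]] /=; rewrite !IHn.
Qed.

Lemma vIm_vcplx (S : Type) (n : nat) (X Y : imv S n) : vIm (vcplx X Y) = Y.
Proof.
by elim: n X Y => [[] []//|n IHn] [u [g s]] [v [d t]] /=; rewrite !IHn.
Qed.

(** * Semantics and cost of vector programs *)

Lemma result_bind (R : realFieldType) (T U : Type) (p : prog R R T)
    (f : T -> prog R R U) :
  result (bind p f) = result (f (result p)).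
Proof. by elim: p => [//|c k IHk|o a b k IHk] /=. Qed.

Lemma cost_bind (R : realFieldType) (T U : Type) (p : prog R R T)
    (f : T -> prog R R U) :
  cost (bind p f) = (cost p + cost (f (result p)))%N.
Proof.
by rewrite /cost; elim: p => [//|c k IHk|o a b k IHk] /=; rewrite IHk.
Qed.

Lemma vget_vmap (R : realFieldType) (T U : Type) (f : T -> prog R R U)
    (n : nat) (X : imv T n) i :
  vget (result (vmap f X)) i = result (f (vget X i)).
Proof.
elim: n X i => [X []|n IHn] [u [g s]] i /=; rewrite !result_bind /=.
by case: i => [j|[j|]].
Qed.

Lemma vget_vmap2 (R : realFieldType) (T U W : Type)
    (f : T -> U -> prog R R W) (n : nat) (X : imv T n) (Y : imv U n) i :
  vget (result (vmap2 f X Y)) i = result (f (vget X i) (vget Y i)).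
Proof.
elim: n X Y i => [X Y []|n IHn] [u [g s]] [v [d t]] i /=.
by rewrite !result_bind /=; case: i => [j|[j|]].
Qed.

Lemma cost_vmap (R : realFieldType) (T U : Type) (f : T -> prog R R U)
    (k n : nat) (X : imv T n) :
  (forall x, cost (f x) = k) -> cost (vmap f X) = (k * (2 ^ n - 1))%N.
Proof.
move=> costf; elim: n X => [|n IHn] X; first by rewrite muln0.
case: X => u [g s] /=; rewrite !cost_bind !IHn costf expnS /cost /=.
by have := expn_gt0 2 n; nia.
Qed.

Lemma cost_vmap2 (R : realFieldType) (T U W : Type)
    (f : T -> U -> prog R R W) (k n : nat) (X : imv T n) (Y : imv U n) :
  (forall x y, cost (f x y) = k) -> cost (vmap2 f X Y) = (k * (2 ^ n - 1))%N.
Proof.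
move=> costf; elim: n X Y => [|n IHn] X Y; first by rewrite muln0.
case: X Y => u [g s] [v [d t]] /=; rewrite !cost_bind !IHn costf expnS.
by rewrite /cost /=; have := expn_gt0 2 n; nia.
Qed.

Lemma cost_vdot (R : realFieldType) (T : Type) (zero : prog R R T)
    (add mul : T -> T -> prog R R T) (k l n : nat) (X Y : imv T n) :
  cost zero = 0%N -> (forall x y, cost (add x y) = k) ->
  (forall x y, cost (mul x y) = l) ->
  cost (vdot zero add mul X Y) = ((k.*2 + l) * (2 ^ n - 1))%N.
Proof.
move=> cost0 costD costM; elim: n X Y => [|n IHn] X Y; first by rewrite muln0.
case: X Y => u [g s] [v [d t]] /=; rewrite !cost_bind !IHn !costD costM expnS.
by have := expn_gt0 2 n; nia.
Qed.

(** * The cross product on the imaginary part *)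

Fixpoint dot {R : realFieldType} {n : nat} : imv R n -> imv R n -> R :=
  if n is m.+1 return imv R n -> imv R n -> R then
    fun X Y => dot X.1 Y.1 + X.2.1 * Y.2.1 + dot X.2.2 Y.2.2
  else fun _ _ => 0.

(** Tabulating the values makes linear combinations of pairs reduce to pairs of
    linear combinations, as [lincombE] records. *)
Definition lincomb {R : realFieldType} {n : nat} (a : R) (X : imv R n) (b : R)
    (Y : imv R n) : imv R n :=
  vtab (fun i => a * vget X i + b * vget Y i).

(** The imaginary part of the product of two imaginary elements
    (see [cdmul_join]). *)
Fixpoint cross {R : realFieldType} {n : nat} : imv R n -> imv R n -> imv R n :=
  if n is m.+1 return imv R n -> imv R n -> imv R n then
    fun X Y =>
      let: (u, (g, s)) := X in let: (v, (d, t)) := Y in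
      (vtab (fun i => vget (cross u v) i - vget (cross s t) i
                      + g * vget t i - d * vget s i),
       (dot s v - dot t u,
        vtab (fun i => d * vget u i - g * vget v i
                       - (vget (cross u t) i + vget (cross s v) i))))
  else fun _ _ => tt.

Lemma lincombE (R : realFieldType) (n : nat) a b (u s v t : imv R n) g d :
  lincomb (n := n.+1) a (u, (g, s)) b (v, (d, t)) =
  (lincomb a u b v, (a * g + b * d, lincomb a s b t)).
Proof. by []. Qed.

Lemma crossE (R : realFieldType) (n : nat) (u s v t : imv R n) g d :
  cross (n := n.+1) (u, (g, s)) (v, (d, t)) =
  (vtab (fun i => vget (cross u v) i - vget (cross s t) i
                  + g * vget t i - d * vget s i),
   (dot s v - dot t u,
    vtab (fun i => d * vget u i - g * vget v i
                   - (vget (cross u t) i + vget (cross s v) i)))).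
Proof. by []. Qed.

Lemma dotC (R : realFieldType) (n : nat) (X Y : imv R n) : dot X Y = dot Y X.
Proof.
elim: n X Y => [//|n IHn] X Y /=.
by rewrite [dot X.1 _]IHn [dot X.2.2 _]IHn [X.2.1 * _]mulrC.
Qed.

Lemma dot_lincombl (R : realFieldType) (n : nat) a b (X Y Z : imv R n) :
  dot (lincomb a X b Y) Z = a * dot X Z + b * dot Y Z.
Proof.
elim: n X Y Z => [|n IHn] X Y Z; first by rewrite /= !mulr0 addr0.
by case: X Y => u [g s] [v [d t]]; rewrite lincombE /= !IHn; ring.
Qed.

(** The formula for [cross] is not visibly antisymmetric, but exchanging the
    two arguments exchanges (u, g, s) with (v, d, t), so this follows from
    antisymmetry in half the dimension. *)
Lemma crossC (R : realFieldType) (n : nat) (X Y : imv R n) :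
  cross Y X = lincomb (-1) (cross X Y) 0 (cross X Y).
Proof.
elim: n X Y => [//|n IHn] [u [g s]] [v [d t]]; rewrite !crossE lincombE.
congr (_, (_, _)).
- apply: vext => i; rewrite !vgetK [cross v u]IHn [cross t s]IHn !vgetK.
  by ring.
- by ring.
apply: vext => i; rewrite !vgetK [cross v s]IHn [cross t u]IHn !vgetK.
by ring.
Qed.

Lemma cross_lincombl (R : realFieldType) (n : nat) a b (X Y Z : imv R n) :
  cross (lincomb a X b Y) Z = lincomb a (cross X Z) b (cross Y Z).
Proof.
elim: n X Y Z => [//|n IHn] [u [g s]] [v [d t]] [w [e r]].
rewrite lincombE !crossE lincombE !IHn.
congr (_, (_, _)); first by apply: vext => i; rewrite !vgetK; ring.
  by rewrite ![dot r _]dotC !dot_lincombl; ring.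
by apply: vext => i; rewrite !vgetK; ring.
Qed.

Lemma cross_lincombr (R : realFieldType) (n : nat) a b (X Y Z : imv R n) :
  cross Z (lincomb a X b Y) = lincomb a (cross Z X) b (cross Z Y).
Proof.
rewrite crossC cross_lincombl [cross Z X]crossC [cross Z Y]crossC.
by apply: vext => i; rewrite !vgetK; ring.
Qed.

(** * Multiplication in the Cayley-Dickson tower *)

Lemma cdadd_join (R : realFieldType) (n : nat) a b (X Y : imv R n) :
  cdadd (cdjoin a X) (cdjoin b Y) = cdjoin (a + b) (lincomb 1 X 1 Y).
Proof.
elim: n a b X Y => [//|n IHn] a b [u [g s]] [v [d t]].
by rewrite lincombE /= !IHn !mul1r.
Qed.

Lemma cdopp_join (R : realFieldType) (n : nat) a (X : imv R n) :
  cdopp (cdjoin a X) = cdjoin (- a) (lincomb (-1) X 0 X).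
Proof.
elim: n a X => [//|n IHn] a [u [g s]]; rewrite lincombE /=.
by rewrite !IHn mul0r addr0 mulN1r.
Qed.

Lemma cdconj_join (R : realFieldType) (n : nat) a (X : imv R n) :
  cdconj (cdjoin a X) = cdjoin a (lincomb (-1) X 0 X).
Proof.
elim: n a X => [//|n IHn] a [u [g s]]; rewrite lincombE /=.
by rewrite IHn cdopp_join mul0r addr0 mulN1r.
Qed.

(** The real part of the product is - <X, Y> because (d + t) is conjugated in
    the first component, which turns its contribution into d g + <t, s>.  The
    cross products come out of the doubling formula in the order t, s and t, u,
    and antisymmetry puts them in the order used by [cross]. *)
Lemma cdmul_join (R : realFieldType) (n : nat) a b (X Y : imv R n) :
  cdmul (cdjoin a X) (cdjoin b Y) =
  cdjoin (a * b - dot X Y)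
         (vtab (fun i => a * vget Y i + b * vget X i + vget (cross X Y) i)).
Proof.
elim: n a b X Y => [|n IHn] a b; first by move=> [] [] /=; rewrite subr0.
move=> [u [g s]] [v [d t]]; rewrite crossE /=.
rewrite /cdsub !cdconj_join !IHn cdopp_join !cdadd_join.
rewrite [cross t u]crossC !cross_lincombl !cross_lincombr.
rewrite [cross t s]crossC ![dot _ (lincomb _ _ _ _)]dotC !dot_lincombl.
congr (cdjoin _ _, cdjoin _ _).
- by rewrite [dot s t]dotC; ring.
- by apply: vext => i; rewrite !vgetK; ring.
- by rewrite [dot v s]dotC; ring.
by apply: vext => i; rewrite !vgetK; ring.
Qed.

(** * Correctness of the algorithms *)

Lemma result_rvdot (R : realFieldType) (n : nat) (X Y : imv R n) :
  result (rvdot R X Y) = dot X Y.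
Proof.
rewrite /rvdot; elim: n X Y => [//|n IHn] [u [g s]] [v [d t]] /=.
by rewrite !(result_bind, IHn) /= !(result_bind, IHn).
Qed.

Lemma result_cvdot (R : realFieldType) (n : nat) (X Y : imv (cplx R) n) :
  result (cvdot R X Y) = (dot (vRe X) (vRe Y) - dot (vIm X) (vIm Y),
                        dot (vRe X) (vIm Y) + dot (vIm X) (vRe Y)).
Proof.
rewrite /cvdot; elim: n X Y => [|n IHn] X Y /=; first by rewrite subr0 addr0.
case: X Y => [u [g s]] [v [d t]]; rewrite !(result_bind, IHn) /=.
rewrite !(result_bind, IHn) /=; congr (_, _); ring.
Qed.

Definition vgetE := (vgetK, vget_vRe, vget_vIm, vget_vmap, vget_vmap2).

Lemma vRe_cvaddi (R : realFieldType) (n : nat) (X Y : imv (cplx R) n) :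
  vRe (result (cvaddi R X Y)) = lincomb 1 (vRe X) (-1) (vIm Y).
Proof. by apply: vext => i; rewrite !vgetE /=; ring. Qed.

Lemma vIm_cvaddi (R : realFieldType) (n : nat) (X Y : imv (cplx R) n) :
  vIm (result (cvaddi R X Y)) = lincomb 1 (vIm X) 1 (vRe Y).
Proof. by apply: vext => i; rewrite !vgetE /=; ring. Qed.

Lemma vRe_cvsubi (R : realFieldType) (n : nat) (X Y : imv (cplx R) n) :
  vRe (result (cvsubi R X Y)) = lincomb 1 (vRe X) 1 (vIm Y).
Proof. by apply: vext => i; rewrite !vgetE /=; ring. Qed.

Lemma vIm_cvsubi (R : realFieldType) (n : nat) (X Y : imv (cplx R) n) :
  vIm (result (cvsubi R X Y)) = lincomb 1 (vIm X) (-1) (vRe Y).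
Proof. by apply: vext => i; rewrite !vgetE /=; ring. Qed.

(* Without this, unfolding one step at m.+2 would go on into the recursive
   calls at m.+1. *)
Arguments algC : simpl nomatch.

(** With X = A + i B and Y = C + i D, complex bilinearity reads
    X x Y = (A x C - B x D) + i (A x D + B x C).  This form needs only the real
    cross product, so the recombination of the two recursive calls reduces to
    the bilinearity of the latter. *)
Lemma result_algC (R : realFieldType) (n : nat) (X Y : imv (cplx R) n) :
  vRe (result (algC R X Y)) =
    lincomb 1 (cross (vRe X) (vRe Y)) (-1) (cross (vIm X) (vIm Y)) /\
  vIm (result (algC R X Y)) =
    lincomb 1 (cross (vRe X) (vIm Y)) 1 (cross (vIm X) (vRe Y)).
Proof.
elim: n X Y => [//|[|m] IHm] X Y.
  by case: X Y => [[] [g []]] [[] [d []]]; rewrite /lincomb /=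
    !(subrr, mulr0, addr0).
have step (u s v t : imv (cplx R) m.+1) g d (X' := (u, (g, s)) : imv _ m.+2)
    (Y' := (v, (d, t)) : imv _ m.+2) :
    vRe (result (algC R X' Y')) =
      lincomb 1 (cross (vRe X') (vRe Y')) (-1) (cross (vIm X') (vIm Y')) /\
    vIm (result (algC R X' Y')) =
      lincomb 1 (cross (vRe X') (vIm Y')) 1 (cross (vIm X') (vRe Y')).
  rewrite {}/X' {}/Y'; cbn [algC]; rewrite !result_bind.
  (* An abstract dimension keeps the vectors from being split any further. *)
  move: (m.+1) IHm u s v t {X Y} => k IHk u s v t.
  have [ReZp ImZp] := IHk (result (cvaddi R u s)) (result (cvaddi R v t)).
  have [ReZm ImZm] := IHk (result (cvsubi R u s)) (result (cvsubi R v t)).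
  move: ReZp ImZp ReZm ImZm.
  rewrite !(vRe_cvaddi, vIm_cvaddi, vRe_cvsubi, vIm_cvsubi).
  rewrite !cross_lincombl !cross_lincombr.
  move: (result (algC _ _ _)) (result (algC _ _ _)) => Zm Zp.
  move=> ReZp ImZp ReZm ImZm.
  rewrite !result_cvdot /= !lincombE.
  split; congr (_, (_, _)); try by ring.
  - apply: vext => i; rewrite !vgetE /= -!vget_vRe -!vget_vIm ReZp ReZm.
    by rewrite !vgetK; field.
  - apply: vext => i; rewrite !vgetE /= -!vget_vRe -!vget_vIm ImZp ImZm.
    by rewrite !vgetK; field.
  - apply: vext => i; rewrite !vgetE /= -!vget_vRe -!vget_vIm ImZp ImZm.
    by rewrite !vgetK; field.
  apply: vext => i; rewrite !vgetE /= -!vget_vRe -!vget_vIm ReZp ReZm.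
  by rewrite !vgetK; field.
by case: X Y => [u [g s]] [v [d t]]; apply: step.
Qed.

Lemma result_algR (R : realFieldType) (n : nat) (X Y : imv R n) :
  result (algR R X Y) = cross X Y.
Proof.
case: n X Y => [//|[|m]] X Y.
  by case: X Y => [[] [g []]] [[] [d []]]; rewrite /= subrr.
have step (u s v t : imv R m.+1) g d :
    result (algR R (n := m.+2) (u, (g, s)) (v, (d, t))) =
    cross (n := m.+2) (u, (g, s)) (v, (d, t)).
  rewrite crossE; cbn [algR]; rewrite !result_bind !result_rvdot.
  have [] := result_algC _ _ (vcplx u s) (vcplx v t).
  rewrite !(vRe_vcplx, vIm_vcplx).
  move: (result (algC _ _ _)) => Z.
  (* An abstract dimension keeps the vectors from being split any further. *)
  move: (m.+1) u s v t Z {X Y} => k u s v t Z ReZ ImZ.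
  congr (_, (_, _)); apply: vext => i; rewrite !vgetE /= -?vget_vRe -?vget_vIm.
    by rewrite ReZ !vgetK; ring.
  by rewrite ImZ !vgetK; ring.
by case: X Y => [u [g s]] [v [d t]]; apply: step.
Qed.

Lemma result_algM (R : realFieldType) (n : nat) (x y : cd R n) :
  result (algM R x y) = cdmul x y.
Proof.
case: n x y => [//|n] x y; rewrite -[x in RHS]cdsplitK -[y in RHS]cdsplitK.
rewrite cdmul_join; cbn [algM].
case: (cdsplit x) (cdsplit y) => [a X] [b Y].
rewrite !result_bind result_algR result_rvdot; cbn [result rmul rsub arith].
move: (n.+1) X Y {x y} => k X Y; congr (cdjoin _ _).
by apply: vext => i; rewrite !vgetE /=; ring.
Qed.

(** * Operation counts *)

(** A complex addition costs 2 and a complex multiplication 6; each of the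
    2^n - 1 coordinates in a bilinear form costs one multiplication and two
    additions. *)
Lemma cost_cvec (R : realFieldType) (n : nat) (V := imv (cplx R) n)
    (D := (2 ^ n - 1)%N) :
  (forall X Y : V, cost (cvadd R X Y) = 2 * D)%N *
  (forall X Y : V, cost (cvsub R X Y) = 2 * D)%N *
  (forall X Y : V, cost (cvaddi R X Y) = 2 * D)%N *
  (forall X Y : V, cost (cvsubi R X Y) = 2 * D)%N *
  (forall X : V, cost (cvhalf R X) = 2 * D)%N *
  (forall c (X : V), cost (cvscale R c X) = 6 * D)%N *
  (forall X Y : V, cost (cvdot R X Y) = 10 * D)%N.
Proof.
do !split=> *; last exact: (@cost_vdot _ _ _ _ _ 2 6).
all: by first [exact: cost_vmap2 | exact: cost_vmap].
Qed.

Lemma cost_rvec (R : realFieldType) (n : nat) (V := imv R n)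
    (D := (2 ^ n - 1)%N) :
  (forall X Y : V, cost (rvadd R X Y) = D) *
  (forall X Y : V, cost (rvsub R X Y) = D) *
  (forall c (X : V), cost (rvscale R c X) = D) *
  (forall X Y : V, cost (rvdot R X Y) = 3 * D)%N.
Proof.
do !split=> *; last exact: (@cost_vdot _ _ _ _ _ 1 1).
all: by rewrite -[RHS]mul1n; first [exact: cost_vmap2 | exact: cost_vmap].
Qed.

(** Put D = 2^m - 1.  Outside its two recursive calls, a step in dimension m + 1
    costs 8 D for the arguments u +- i s and v +- i t, 20 D + 2 for lambda and
    40 D for the recombination: at most 68 * 2^m = 34 * 2^(m+1). *)
Lemma cost_algC (R : realFieldType) (n : nat) (X Y : imv (cplx R) n) :
  (cost (algC R X Y) <= 34 * (n * 2 ^ n))%N.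
Proof.
elim: n X Y => [//|[|m] IHm] X Y; first by [].
have step (u s v t : imv (cplx R) m.+1) g d :
    (cost (algC R (n := m.+2) (u, (g, s)) (v, (d, t)))
     <= 34 * (m.+2 * 2 ^ m.+2))%N.
  rewrite [(2 ^ m.+2)%N]expnS; cbn [algC]; rewrite !cost_bind !cost_cvec.
  have := IHm (result (cvaddi R u s)) (result (cvaddi R v t)).
  have := IHm (result (cvsubi R u s)) (result (cvsubi R v t)).
  have := expn_gt0 2 m.+1; cbn [cost size ops].
  move: (cost (algC _ _ _)) (cost (algC _ _ _)) (2 ^ m.+1)%N => a b D.
  by rewrite /cost /=; nia.
by case: X Y => [u [g s]] [v [d t]]; apply: step.
Qed.

(** The single call in dimension n - 1 costs at most
    34 (n - 1) 2^(n-1) = 17 (n - 1) 2^n, and the rest 14 (2^(n-1) - 1) + 1. *)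
Lemma cost_algR (R : realFieldType) (n : nat) (X Y : imv R n) :
  (cost (algR R X Y) <= 17 * (n.-1 * 2 ^ n) + 7 * 2 ^ n)%N.
Proof.
case: n X Y => [//|[|m]] X Y; first by [].
have step (u s v t : imv R m.+1) g d :
    (cost (algR R (n := m.+2) (u, (g, s)) (v, (d, t)))
     <= 17 * (m.+1 * 2 ^ m.+2) + 7 * 2 ^ m.+2)%N.
  rewrite [(2 ^ m.+2)%N]expnS; cbn [algR]; rewrite !cost_bind !cost_rvec.
  have := cost_algC _ _ (vcplx u s) (vcplx v t); have := expn_gt0 2 m.+1.
  move: (cost (algC _ _ _)) (2 ^ m.+1)%N => a D.
  by rewrite /cost /=; nia.
by case: X Y => [u [g s]] [v [d t]]; apply: step.
Qed.

(** To the bound of [cost_algR] come 7 (2^n - 1) + 2 operations, so the linear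
    terms add up to at most 14 * 2^n, within the 17 * 2^n available. *)
Lemma cost_algM (R : realFieldType) (n : nat) (x y : cd R n) :
  (1 <= n)%N -> (cost (algM R x y) <= 17 * (n * 2 ^ n))%N.
Proof.
case: n x y => [//|n] x y _; cbn [algM].
case: (cdsplit x) (cdsplit y) => [a X] [b Y].
rewrite !cost_bind !cost_rvec.
have := cost_algR _ _ X Y; have := expn_gt0 2 n.+1.
move: (cost (algR _ _ _)) (2 ^ n.+1)%N => c D.
by rewrite /cost /=; nia.
Qed.

Theorem theorem4p1 (R : realType) :
  (forall (n : nat) (x y : cd R n), result (algM R x y) = cdmul x y) /\
  (exists C : nat, forall n : nat, (1 <= n)%N -> forall x y : cd R n,
     (cost (algM R x y) <= C * (n * 2 ^ n))%N) /\
  (exists C : R, forall n N : nat, (1 <= n)%N -> N = (2 ^ n)%N ->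
     forall x y : cd R n,
     (cost (algM R x y))%:R <= C * (N%:R * (ln N%:R / ln 2))) /\
  (forall x y : cd R 0,
     result (algM R x y) = (x : R) * (y : R) /\ ops (algM R x y) = [:: Mul]).
Proof.
split; first exact: result_algM.
split; first by exists 17%N => n n_gt0 x y; apply: cost_algM.
split; last by [].
exists 17%:R => n N n_gt0 -> x y.
have ln2_neq0 : ln 2 != 0 :> R by rewrite gt_eqF // ln_gt0 // ltr1n.
rewrite natrX lnXn // -[ln 2 *+ n]mulr_natl mulfK //.
by rewrite [_ ^+ _ * _]mulrC -natrX -!natrM ler_nat cost_algM.
Qed.
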